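(* Let $\Bbbk$ be a field, and let $\mathcal{C}$ be a Cauchy complete $\Bbbk$-linear braided monoidal category with finite dimensional morphism spaces and $\operatorname{End}(\mathbf{1})=\Bbbk$. If $\mathcal{C}$ has moderate growth, then every non-negligible object $X\in\mathcal{C}$ is rigid.
   Context: A linear category is Cauchy complete if it admits (finite) direct sums and is idempotent (Karoubi) complete. $\mathbf{1}$ denotes the monoidal unit. An indecomposable object $X\in\mathcal{C}$ is non-negligible if there exists $Y\in\mathcal{C}$ such that $\mathbf{1}$ is a direct summand of $Y\otimes X$. An object $X$ has moderate growth if there exists $n\in\mathbb{N}$ such that $\dim_{\Bbbk}\operatorname{End}(X^{\otimes n})<n!$. The category $\mathcal{C}$ has moderate growth if all its indecomposable objects have moderate growth. An object is rigid if it admits a left dual and a right dual. *)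

(* Defs.v *)
(* Finite-dimensional k-linear (braided) monoidal categories, over the
   Mathematical Components library.

   Monoidal categories are not assumed strict.  The finite dimensionality of
   the morphism spaces is built in: a morphism space is a [vectType k].  The
   composite [g ∘ f] means "first f, then g". *)
From mathcomp Require Import all_boot all_order all_algebra.

Set Implicit Arguments.
Unset Strict Implicit.
Unset Printing Implicit Defensive.

Import GRing.Theory.
Local Open Scope ring_scope.

Declare Scope lincat_scope.
Delimit Scope lincat_scope with LC.
Local Open Scope lincat_scope.

Reserved Notation "g ∘ f" (at level 40, left associativity).
Reserved Notation "X ⊗ Y" (at level 35, right associativity).
Reserved Notation "f ⊗ₘ g" (at level 35, right associativity).

Record linear_category (k : fieldType) := LinearCategory {
  ob :> Type;
  hom : ob -> ob -> vectType k;
  idm : forall X, hom X X;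
  compm : forall X Y Z, hom Y Z -> hom X Y -> hom X Z;
  compmA : forall W X Y Z (h : hom Y Z) (g : hom X Y) (f : hom W X),
    compm h (compm g f) = compm (compm h g) f;
  comp1m : forall X Y (f : hom X Y), compm (idm Y) f = f;
  compm1 : forall X Y (f : hom X Y), compm f (idm X) = f;
  compm_linearl : forall X Y Z (f : hom X Y),
    linear (fun g : hom Y Z => compm g f);
  compm_linearr : forall X Y Z (g : hom Y Z),
    linear (fun f : hom X Y => compm g f)
}.

Arguments hom {k l} X Y.
Arguments idm {k l} X.
Arguments compm {k l X Y Z} g f.
Notation "g ∘ f" := (compm g f) : lincat_scope.

Section LinearCategory.
Variables (k : fieldType) (C : linear_category k).
Implicit Types A B S X Y Z : C.

Definition is_iso X Y (f : hom X Y) : Prop :=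
  exists g : hom Y X, g ∘ f = idm X /\ f ∘ g = idm Y.

Definition is_zero Z : Prop :=
  (forall X (f : hom Z X), f = 0) /\ (forall X (f : hom X Z), f = 0).

Definition is_direct_sum S A B : Prop :=
  exists (iA : hom A S) (iB : hom B S) (pA : hom S A) (pB : hom S B),
    [/\ pA ∘ iA = idm A, pB ∘ iB = idm B, pB ∘ iA = 0, pA ∘ iB = 0
      & (iA ∘ pA) + (iB ∘ pB) = idm S].

Definition direct_summand A S : Prop := exists B, is_direct_sum S A B.

Definition indecomposable X : Prop :=
  ~ is_zero X /\ forall A B, is_direct_sum X A B -> is_zero A \/ is_zero B.

End LinearCategory.

(* The empty direct sum is a zero object. *)
Definition has_finite_direct_sums (k : fieldType) (C : linear_category k) :
    Prop :=
  (exists Z : C, is_zero Z) /\ (forall A B : C, exists S, is_direct_sum S A B).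

Definition idempotent_complete (k : fieldType) (C : linear_category k) : Prop :=
  forall (X : C) (e : hom X X), e ∘ e = e ->
    exists (Y : C) (i : hom Y X) (p : hom X Y), p ∘ i = idm Y /\ i ∘ p = e.

Definition cauchy_complete (k : fieldType) (C : linear_category k) : Prop :=
  has_finite_direct_sums C /\ idempotent_complete C.

(* The tensor product is required to be k-bilinear on morphisms. *)
Record monoidal_category (k : fieldType) := MonoidalCategory {
  mon_cat :> linear_category k;
  unit_ob : mon_cat;
  tens : mon_cat -> mon_cat -> mon_cat;
  tensm : forall X X' Y Y' : mon_cat,
    hom X X' -> hom Y Y' -> hom (tens X Y) (tens X' Y');
  tensm1 : forall X Y, tensm (idm X) (idm Y) = idm (tens X Y);
  tensm_comp : forall X X' X'' Y Y' Y'' : mon_cat,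
    forall (f' : hom X' X'') (f : hom X X') (g' : hom Y' Y'') (g : hom Y Y'),
    tensm (f' ∘ f) (g' ∘ g) = tensm f' g' ∘ tensm f g;
  tensm_linearl : forall (X X' Y Y' : mon_cat) (g : hom Y Y'),
    linear (fun f : hom X X' => tensm f g);
  tensm_linearr : forall (X X' Y Y' : mon_cat) (f : hom X X'),
    linear (fun g : hom Y Y' => tensm f g);
  assoc : forall X Y Z, hom (tens (tens X Y) Z) (tens X (tens Y Z));
  assocV : forall X Y Z, hom (tens X (tens Y Z)) (tens (tens X Y) Z);
  assocK : forall X Y Z, assocV X Y Z ∘ assoc X Y Z = idm _;
  assocVK : forall X Y Z, assoc X Y Z ∘ assocV X Y Z = idm _;
  lunit : forall X, hom (tens unit_ob X) X;
  lunit_iso : forall X, is_iso (lunit X);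
  runit : forall X, hom (tens X unit_ob) X;
  runit_iso : forall X, is_iso (runit X);
  assoc_nat : forall X X' Y Y' Z Z' : mon_cat,
    forall (f : hom X X') (g : hom Y Y') (h : hom Z Z'),
    assoc X' Y' Z' ∘ tensm (tensm f g) h
      = tensm f (tensm g h) ∘ assoc X Y Z;
  lunit_nat : forall (X Y : mon_cat) (f : hom X Y),
    lunit Y ∘ tensm (idm unit_ob) f = f ∘ lunit X;
  runit_nat : forall (X Y : mon_cat) (f : hom X Y),
    runit Y ∘ tensm f (idm unit_ob) = f ∘ runit X;
  pentagon : forall W X Y Z,
    assoc W X (tens Y Z) ∘ assoc (tens W X) Y Z
      = tensm (idm W) (assoc X Y Z) ∘ assoc W (tens X Y) Z
          ∘ tensm (assoc W X Y) (idm Z);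
  triangle : forall X Y,
    tensm (idm X) (lunit Y) ∘ assoc X unit_ob Y = tensm (runit X) (idm Y)
}.

Arguments unit_ob {k} m.
Arguments tens {k m} X Y.
Arguments tensm {k m X X' Y Y'} f g.
Arguments assoc {k m} X Y Z.
Arguments assocV {k m} X Y Z.
Arguments lunit {k m} X.
Arguments runit {k m} X.
Notation "X ⊗ Y" := (tens X Y) : lincat_scope.
Notation "f ⊗ₘ g" := (tensm f g) : lincat_scope.

Record braided_category (k : fieldType) := BraidedCategory {
  br_cat :> monoidal_category k;
  braid : forall X Y : br_cat, hom (X ⊗ Y) (Y ⊗ X);
  braid_iso : forall X Y, is_iso (braid X Y);
  braid_nat : forall (X X' Y Y' : br_cat) (f : hom X X') (g : hom Y Y'),
    braid X' Y' ∘ (f ⊗ₘ g) = (g ⊗ₘ f) ∘ braid X Y;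
  hexagon1 : forall X Y Z,
    assoc Y Z X ∘ braid X (Y ⊗ Z) ∘ assoc X Y Z
      = (idm Y ⊗ₘ braid X Z) ∘ assoc Y X Z ∘ (braid X Y ⊗ₘ idm Z);
  hexagon2 : forall X Y Z,
    assocV Z X Y ∘ braid (X ⊗ Y) Z ∘ assocV X Y Z
      = (braid X Z ⊗ₘ idm Y) ∘ assocV X Z Y ∘ (idm X ⊗ₘ braid Y Z)
}.

Section MonoidalCategory.
Variables (k : fieldType) (C : monoidal_category k).
Implicit Types X Y : C.

(* End(1) = k: every endomorphism of 1 is a unique scalar multiple of the
   identity. *)
Definition scalar_unit_endomorphisms : Prop :=
  bijective (fun c : k => c *: idm (unit_ob C)).

Fixpoint tens_pow X (n : nat) : C :=
  if n is m.+1 then tens_pow X m ⊗ X else unit_ob C.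

Definition object_moderate_growth X : Prop :=
  exists n : nat,
    (\dim {: hom (tens_pow X n) (tens_pow X n)} < n`!)%N.

Definition moderate_growth : Prop :=
  forall X, indecomposable X -> object_moderate_growth X.

(* Negligibility is a notion for indecomposable objects only. *)
Definition non_negligible X : Prop :=
  indecomposable X /\ exists Y, direct_summand (unit_ob C) (Y ⊗ X).

(* [ev] and [coev] exhibit Y as a left dual of X, and X as a right dual of Y:
   these are the two zigzag identities. *)
Definition exact_pairing Y X (ev : hom (Y ⊗ X) (unit_ob C))
    (coev : hom (unit_ob C) (X ⊗ Y)) : Prop :=
  runit X ∘ (idm X ⊗ₘ ev) ∘ assoc X Y X ∘ (coev ⊗ₘ idm X) = lunit X /\
  lunit Y ∘ (ev ⊗ₘ idm Y) ∘ assocV Y X Y ∘ (idm Y ⊗ₘ coev) = runit Y.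

Definition is_left_dual Y X : Prop :=
  exists ev coev, @exact_pairing Y X ev coev.

Definition is_right_dual Y X : Prop := is_left_dual X Y.

Definition rigid X : Prop :=
  (exists Y, is_left_dual Y X) /\ (exists Y, is_right_dual Y X).

End MonoidalCategory.

(* Main.v *)
From HB Require Import structures.
From mathcomp Require Import all_boot all_order all_algebra.
From Stdlib Require Import ClassicalEpsilon.
Require Import Defs.

(** The first input is that [X] has a dual as soon as some zigzag on [X] is
    invertible.  Given any cap [Y ⊗ X -> 1] and cup [1 -> X ⊗ Y], an
    invertible zigzag on [X] can be normalised to satisfy the first duality
    identity; the zigzag on [Y] is then an idempotent, and splitting it gives a
    left dual ([left_dual_of_zigzag_iso]).  By the hexagon, the partial trace
    [X -> X ⊗ X ⊗ Y -> X ⊗ X ⊗ Y -> X] of the braiding of [X] with itself, or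
    of its inverse, is such a zigzag up to invertible factors
    ([left_dual_of_ptrace_iso]).

    Suppose now that [X] has no left dual, so that none of these partial traces
    is invertible.  Call an endomorphism negligible if every closed diagram
    through it vanishes.  As [End(X)] is a finite-dimensional local algebra, it
    contains a non-negligible [a] such that [r ∘ a] is negligible for every
    non-invertible [r] ([exists_extremal_endomorphism]).  A closed diagram that
    detects [a] provides a cap and a cup which, after [a] is absorbed into the
    cap, compose to the identity of [1] and for which the partial traces of the
    braiding and its inverse are negligible.

    These data force factorial growth.  Modulo negligible endomorphisms, the
    partial trace [End(X^(n+1)) -> End(X^n)] is a unital bimodule map that kills
    the double cosets of the last braid generator and of its inverse.  The braid
    group on [n+1] strands has [n+1] elements any distinct two of which differ
    by an element of these double cosets ([coset_braid_double_coset]).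
    Multiplying them with a family of [n!] endomorphisms of [X^n] that is
    independent modulo negligible ones gives [(n+1)!] such endomorphisms of
    [X^(n+1)] ([factorial_family]), so [dim End(X^n) >= n!] for all [n], against
    moderate growth.

    Thus [X] has a left dual.  The right dual is obtained from the same result
    for the category with the opposite tensor product. *)

Set Implicit Arguments.
Unset Strict Implicit.
Unset Printing Implicit Defensive.

Import GRing.Theory.
Local Open Scope ring_scope.
Local Open Scope lincat_scope.

(** * Linear categories *)

Section LinearCategoryTheory.
Variables (k : fieldType) (C : linear_category k).
Implicit Types A B X Y Z W : C.

Definition precomp X Y Z (f : hom X Y) (g : hom Y Z) : hom X Z := g ∘ f.
Definition postcomp X Y Z (g : hom Y Z) (f : hom X Y) : hom X Z := g ∘ f.

HB.instance Definition _ X Y Z (f : hom X Y) :=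
  GRing.isLinear.Build k (hom Y Z) (hom X Z) _ (@precomp X Y Z f)
    (compm_linearl f).
HB.instance Definition _ X Y Z (g : hom Y Z) :=
  GRing.isLinear.Build k (hom X Y) (hom X Z) _ (@postcomp X Y Z g)
    (compm_linearr g).

Lemma comp0m X Y Z (f : hom X Y) : (0 : hom Y Z) ∘ f = 0.
Proof. exact: (linear0 (@precomp X Y Z f)). Qed.
Lemma compm0 X Y Z (g : hom Y Z) : g ∘ (0 : hom X Y) = 0.
Proof. exact: (linear0 (@postcomp X Y Z g)). Qed.
Lemma compDm X Y Z (g h : hom Y Z) (f : hom X Y) : (g + h) ∘ f = g ∘ f + h ∘ f.
Proof. exact: (linearD (@precomp X Y Z f)). Qed.
Lemma compmD X Y Z (g : hom Y Z) (f h : hom X Y) : g ∘ (f + h) = g ∘ f + g ∘ h.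
Proof. exact: (linearD (@postcomp X Y Z g)). Qed.
Lemma compBm X Y Z (g h : hom Y Z) (f : hom X Y) : (g - h) ∘ f = g ∘ f - h ∘ f.
Proof. exact: (linearB (@precomp X Y Z f)). Qed.
Lemma compmB X Y Z (g : hom Y Z) (f h : hom X Y) : g ∘ (f - h) = g ∘ f - g ∘ h.
Proof. exact: (linearB (@postcomp X Y Z g)). Qed.
Lemma compZm X Y Z c (g : hom Y Z) (f : hom X Y) : (c *: g) ∘ f = c *: (g ∘ f).
Proof. exact: (linearZ_LR (@precomp X Y Z f)). Qed.
Lemma compmZ X Y Z c (g : hom Y Z) (f : hom X Y) : g ∘ (c *: f) = c *: (g ∘ f).
Proof. exact: (linearZ_LR (@postcomp X Y Z g)). Qed.
Lemma comp_suml X Y Z I r (P : pred I) (F : I -> hom Y Z) (f : hom X Y) :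
  (\sum_(i <- r | P i) F i) ∘ f = \sum_(i <- r | P i) (F i ∘ f).
Proof. exact: (linear_sum (@precomp X Y Z f)). Qed.
Lemma comp_sumr X Y Z I r (P : pred I) (F : I -> hom X Y) (g : hom Y Z) :
  g ∘ (\sum_(i <- r | P i) F i) = \sum_(i <- r | P i) (g ∘ F i).
Proof. exact: (linear_sum (@postcomp X Y Z g)). Qed.

(** Composites are kept nested to the left, so an equation between composites
    is used below an outer factor [h] in the following form. *)
Lemma under_comp X Y Z W (g : hom Y Z) (f : hom X Y) (e : hom X Z)
  (h : hom Z W) : g ∘ f = e -> h ∘ g ∘ f = h ∘ e.
Proof. by move=> <-; rewrite compmA. Qed.

Lemma iso_comp X Y Z (g : hom Y Z) (f : hom X Y) :
  is_iso g -> is_iso f -> is_iso (g ∘ f).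
Proof.
move=> [g' [g'g gg']] [f' [f'f ff']]; exists (f' ∘ g'); split.
  by rewrite compmA (under_comp _ g'g) compm1.
by rewrite compmA (under_comp _ ff') compm1.
Qed.

Lemma iso_id X : is_iso (idm X).
Proof. by exists (idm X); rewrite comp1m. Qed.

Definition iso_inv X Y (f : hom X Y) (hf : is_iso f) : hom Y X :=
  proj1_sig (constructive_indefinite_description _ hf).

Lemma iso_invK X Y (f : hom X Y) (hf : is_iso f) : iso_inv hf ∘ f = idm X.
Proof. by rewrite /iso_inv; case: constructive_indefinite_description => g []. Qed.

Lemma iso_invVK X Y (f : hom X Y) (hf : is_iso f) : f ∘ iso_inv hf = idm Y.
Proof. by rewrite /iso_inv; case: constructive_indefinite_description => g []. Qed.

Lemma iso_inv_iso X Y (f : hom X Y) (hf : is_iso f) : is_iso (iso_inv hf).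
Proof. by exists f; rewrite iso_invK iso_invVK. Qed.

Lemma iso_cancelr X Y Z (f : hom X Y) (g h : hom Y Z) :
  is_iso f -> g ∘ f = h ∘ f -> g = h.
Proof.
move=> [f' [_ ff']] E.
by rewrite -[g]compm1 -[h]compm1 -ff' !compmA E.
Qed.

Lemma iso_cancell X Y Z (f : hom Y Z) (g h : hom X Y) :
  is_iso f -> f ∘ g = f ∘ h -> g = h.
Proof.
move=> [f' [f'f _]] E.
by rewrite -[g]comp1m -[h]comp1m -f'f -!compmA E.
Qed.

Lemma dim_end_le A B (f : hom A B) : is_iso f ->
  (\dim {: hom A A} <= \dim {: hom B B})%N.
Proof.
move=> [g [gf fg]].
pose L := linfun (precomp g \o @postcomp A A B f : hom A A -> hom B B).
have Linj : lker L == 0%VS.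
  apply/lker0P => x y; rewrite !lfunE /= /precomp /postcomp => E.
  by rewrite -[x]comp1m -[y]comp1m -gf -[LHS]compm1 -[RHS]compm1 -gf !compmA
    -!(compmA g) E.
by rewrite -(limg_dim_eq (f:=L)) ?dimvS ?subvf // (eqP Linj) capv0.
Qed.

Lemma card_le_dim (V : vectType k) (T : finType) (w : T -> V) :
  (forall l : T -> k, \sum_t l t *: w t = 0 -> forall t, l t = 0) ->
  (#|T| <= \dim {: V})%N.
Proof.
move=> w_indep.
pose s := [tuple w (enum_val i) | i < #|T|].
have fs : free s.
  apply/freeP => l El i.
  have := w_indep (fun t => l (enum_rank t)) _ (enum_val i).
  rewrite enum_valK; apply.
  rewrite (reindex (@enum_val T predT)) /=; last exact: onW_bij (enum_val_bij _).
  rewrite -[RHS]El; apply: eq_bigr => j _.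
  by rewrite enum_valK (nth_map j) ?size_tuple // ?size_enum_ord // nth_ord_enum.
rewrite -(size_tuple s) -(eqP (fs : \dim <<s>>%VS == size s)).
exact: dimvS (subvf _).
Qed.

End LinearCategoryTheory.

(** * Endomorphisms of an indecomposable object *)

Section LocalEndomorphisms.
Variables (k : fieldType) (C : linear_category k).
Hypothesis hC : idempotent_complete C.
Variable X : C.
Hypothesis hX : indecomposable X.
Implicit Types s t w y z : hom X X.

Lemma indecomposable_id_neq0 : idm X <> 0.
Proof.
move=> E; case: hX => nz _; apply: nz; split=> Z f.
  by rewrite -(compm1 f) E compm0.
by rewrite -(comp1m f) E comp0m.
Qed.

Lemma indecomposable_idempotent y : y ∘ y = y -> y = 0 \/ y = idm X.
Proof.
move=> yy.
pose y' := idm X - y.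
have y'y : y' ∘ y = 0 by rewrite /y' compBm comp1m yy subrr.
have yy' : y ∘ y' = 0 by rewrite /y' compmB compm1 yy subrr.
have y'y' : y' ∘ y' = y' by rewrite {2}/y' compmB compm1 y'y subr0.
have [A [i [p [pi ip]]]] := hC yy.
have [B [i' [p' [pi' ip']]]] := hC y'y'.
have zeroAB : p' ∘ i = 0.
  by rewrite -(comp1m p') -(compm1 i) -pi' -pi -!(compmA p') !compmA
    (under_comp _ ip') -!compmA (compmA i p i) ip (compmA y') y'y comp0m compm0.
have zeroBA : p ∘ i' = 0.
  by rewrite -(comp1m p) -(compm1 i') -pi' -pi !compmA (under_comp _ ip)
    -!compmA (compmA i' p' i') ip' (compmA y) yy' comp0m compm0.
have [|[A0 _]|[B0 _]] := hX.2 A B.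
- exists i, i', p, p'; split=> //.
  by rewrite ip ip' /y' addrC subrK.
- by left; rewrite -ip (A0 _ i) comp0m.
right; have : y' = 0 by rewrite -ip' (B0 _ i') comp0m.
by move/eqP; rewrite /y' subr_eq0 => /eqP ->.
Qed.

Lemma one_sided_inverse s t : s ∘ t = idm X -> is_iso s /\ is_iso t.
Proof.
move=> st.
have [] := @indecomposable_idempotent (t ∘ s).
- by rewrite compmA (under_comp _ st) compm1.
- move=> ts; case: indecomposable_id_neq0.
  by rewrite -[idm X]comp1m -st compmA -(compmA s t s) ts compm0 comp0m.
by move=> ts; split; [exists t | exists s].
Qed.

Definition right_ideal w : {vspace hom X X} :=
  limg (linfun (@postcomp _ _ X _ _ w)).

Lemma right_idealP w z : reflect (exists x, z = w ∘ x) (z \in right_ideal w).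
Proof.
apply: (iffP memv_imgP) => [[x _ ->]|[x ->]]; exists x; rewrite ?memvf //.
  by rewrite lfunE.
by rewrite lfunE.
Qed.

(** Fitting's argument: if [w] and [w ∘ w] generate the same right ideal [I],
    then [w] acts bijectively on [I]; the solution [y] in [I] of [w ∘ y = w] is
    an idempotent, and it is nonzero since [w] is. *)
Lemma fitting w : (\dim (right_ideal w) <= \dim (right_ideal (w ∘ w)))%N ->
  w <> 0 -> exists z, w ∘ z = idm X.
Proof.
move=> dimw w0.
pose L := linfun (@postcomp _ _ X _ _ w).
have LE x : L x = w ∘ x by rewrite lfunE.
have sub : (right_ideal (w ∘ w) <= right_ideal w)%VS.
  apply/subvP => x /right_idealP [u ->]; apply/right_idealP.
  by exists (w ∘ u); rewrite compmA.
have eqI : right_ideal (w ∘ w) = right_ideal w.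
  by apply/eqP; rewrite eqEdim sub.
have imI : (L @: right_ideal w)%VS = right_ideal w.
  apply/vspaceP => x; rewrite -{2}eqI; apply/memv_imgP/right_idealP.
    by move=> [_ /right_idealP [u ->] ->]; exists u; rewrite LE compmA.
  move=> [u ->]; exists (w ∘ u); rewrite ?LE ?compmA //.
  by apply/right_idealP; exists u.
have kerI : (right_ideal w :&: lker L)%VS = 0%VS.
  have := limg_ker_dim L (right_ideal w); rewrite imI => /eqP.
  by rewrite -[X in _ == X]add0n eqn_add2r dimv_eq0 => /eqP.
have [_ /right_idealP [z ->] wy] : exists2 y, y \in right_ideal w & w = L y.
  have : w \in (L @: right_ideal w)%VS.
    by rewrite imI; apply/right_idealP; exists (idm X); rewrite compm1.
  by move=> /memv_imgP [y yI E]; exists y.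
rewrite LE in wy; set y := w ∘ z in wy.
have yy : y ∘ y = y.
  apply/eqP; rewrite -subr_eq0 -memv0 -kerI memv_cap; apply/andP; split.
    apply: rpredB; apply/right_idealP; last by exists z.
    by exists (z ∘ y); rewrite compmA.
  by rewrite memv_ker LE compmB compmA -!wy subrr.
case: (indecomposable_idempotent yy) => [y0|y1]; last by exists z.
by case: w0; rewrite wy y0 compm0.
Qed.

(** Squaring [t] repeatedly, the right ideals of the powers stop shrinking; all
    these powers are nonzero because they fix [a], so Fitting's argument applies
    to one of them. *)
Lemma fixing_endomorphism_iso (Y : C) (t : hom X X) (a : hom Y X) :
  t ∘ a = a -> a <> 0 -> is_iso t.
Proof.
move=> ta a0.
suff [z tz] : exists z, t ∘ z = idm X by case: (one_sided_inverse tz).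
suff H n w : (\dim (right_ideal w) <= n)%N -> w ∘ a = a -> (exists x, w = t ∘ x) ->
    exists z, t ∘ z = idm X.
  by apply: (H _ t (leqnn _)) => //; exists (idm X); rewrite compm1.
elim: n w => [|n IHn] w dw wa [x wx];
  have w0 : w <> 0 by move=> w0; apply: a0; rewrite -wa w0 comp0m.
  case: w0; apply/eqP; rewrite -memv0 -[0%VS](_ : right_ideal w = _).
    by apply/right_idealP; exists (idm X); rewrite compm1.
  by apply/eqP; rewrite -dimv_eq0 -leqn0.
have [dle|dlt] := leqP (\dim (right_ideal w)) (\dim (right_ideal (w ∘ w))).
  by have [z wz] := fitting dle w0; exists (x ∘ z); rewrite compmA -wx.
apply: (IHn (w ∘ w)).
- by rewrite -ltnS; apply: leq_trans dlt _.
- by rewrite -compmA wa.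
by exists (x ∘ w); rewrite compmA -wx.
Qed.

(** Minimising the dimension of the left ideal generated by [a] over the
    endomorphisms [a] outside [N] gives an [a] that every non-isomorphism [r]
    carries into [N]: otherwise [a = s ∘ r ∘ a] for some [s], so [s ∘ r] and
    with it [r] would be invertible. *)
Lemma exists_extremal_endomorphism (N : hom X X -> Prop) :
  N 0 -> ~ N (idm X) ->
  exists2 a, ~ N a & forall r, ~ is_iso r -> N (r ∘ a).
Proof.
move=> N0 N1.
pose I a := limg (linfun (@precomp _ _ _ _ X a : hom X X -> hom X X)).
have IP a z : z \in I a -> exists s, z = s ∘ a.
  by move=> /memv_imgP [s _ ->]; exists s; rewrite lfunE.
have PI s a : s ∘ a \in I a.
  by apply/memv_imgP; exists s; rewrite ?memvf // lfunE.
suff H n a : (\dim (I a) <= n)%N -> ~ N a ->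
    exists2 a, ~ N a & forall r, ~ is_iso r -> N (r ∘ a).
  exact: (H _ (idm X) (leqnn _)).
elim: n a => [|n IHn] a da Na.
  case: Na; rewrite (_ : a = 0) //.
  apply/eqP; rewrite -memv0; suff <- : I a = 0%VS.
    by rewrite -[X in X \in _]comp1m.
  by apply/eqP; rewrite -dimv_eq0 -leqn0.
case: (classic (exists2 r, ~ is_iso r & ~ N (r ∘ a))) => [[r nr Nra]|nex]; last first.
  exists a => // r nr; case: (classic (N (r ∘ a))) => // Nra.
  by case: nex; exists r.
have sub : (I (r ∘ a) <= I a)%VS.
  by apply/subvP => z /IP [s ->]; rewrite compmA.
have [dle|dlt] := leqP (\dim (I a)) (\dim (I (r ∘ a))); last first.
  by apply: (IHn (r ∘ a)) => //; rewrite -ltnS; apply: leq_trans dlt _.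
case: nr.
have /IP [s as_] : a \in I (r ∘ a).
  have -> : I (r ∘ a) = I a by apply/eqP; rewrite eqEdim sub.
  by rewrite -[X in X \in _]comp1m.
have [||q [qsr _]] := @fixing_endomorphism_iso X (s ∘ r) a.
- by rewrite -compmA -as_.
- by move=> a0; apply: Na; rewrite a0.
by have [] := @one_sided_inverse (q ∘ s) r; first by rewrite -compmA.
Qed.

End LocalEndomorphisms.

(** * Coherence of units *)

Section MonoidalCategoryTheory.
Variables (k : fieldType) (C : monoidal_category k).
Implicit Types T U W X Y Z : C.
Local Notation "1" := (unit_ob C) : lincat_scope.

Definition tensr X X' Y Y' (g : hom Y Y') (f : hom X X') : hom (X ⊗ Y) (X' ⊗ Y') :=
  f ⊗ₘ g.

HB.instance Definition _ X X' Y Y' (g : hom Y Y') :=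
  GRing.isLinear.Build k (hom X X') (hom (X ⊗ Y) (X' ⊗ Y')) _
    (@tensr X X' Y Y' g) (tensm_linearl g).

Lemma tens0m X X' Y Y' (g : hom Y Y') : (0 : hom X X') ⊗ₘ g = 0.
Proof. exact: (linear0 (@tensr X X' Y Y' g)). Qed.
Lemma tensDm X X' Y Y' (f h : hom X X') (g : hom Y Y') :
  (f + h) ⊗ₘ g = (f ⊗ₘ g) + (h ⊗ₘ g).
Proof. exact: (linearD (@tensr X X' Y Y' g)). Qed.
Lemma tensZm X X' Y Y' c (f : hom X X') (g : hom Y Y') :
  (c *: f) ⊗ₘ g = c *: (f ⊗ₘ g).
Proof. exact: (linearZ_LR (@tensr X X' Y Y' g)). Qed.
Lemma tens_suml X X' Y Y' I r (P : pred I) (F : I -> hom X X') (g : hom Y Y') :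
  (\sum_(i <- r | P i) F i) ⊗ₘ g = \sum_(i <- r | P i) (F i ⊗ₘ g).
Proof. exact: (linear_sum (@tensr X X' Y Y' g)). Qed.

Lemma tens_compl X X' X'' Y (g : hom X' X'') (f : hom X X') :
  (g ∘ f) ⊗ₘ idm Y = (g ⊗ₘ idm Y) ∘ (f ⊗ₘ idm Y).
Proof. by rewrite -tensm_comp comp1m. Qed.

Lemma tens_compr X X' X'' Y (g : hom X' X'') (f : hom X X') :
  idm Y ⊗ₘ (g ∘ f) = (idm Y ⊗ₘ g) ∘ (idm Y ⊗ₘ f).
Proof. by rewrite -tensm_comp comp1m. Qed.

Lemma tens_swap X X' Y Y' (f : hom X X') (g : hom Y Y') :
  (f ⊗ₘ idm Y') ∘ (idm X ⊗ₘ g) = (idm X' ⊗ₘ g) ∘ (f ⊗ₘ idm Y).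
Proof. by rewrite -!tensm_comp !comp1m !compm1. Qed.

Lemma assocV_nat X X' Y Y' Z Z' (f : hom X X') (g : hom Y Y') (h : hom Z Z') :
  assocV X' Y' Z' ∘ (f ⊗ₘ g ⊗ₘ h) = ((f ⊗ₘ g) ⊗ₘ h) ∘ assocV X Y Z.
Proof.
rewrite -[LHS]compm1 -(assocVK X Y Z) compmA.
by rewrite -(compmA _ _ (assoc X Y Z)) -assoc_nat compmA assocK comp1m.
Qed.

Lemma assoc_iso X Y Z : is_iso (assoc X Y Z).
Proof. by exists (assocV X Y Z); rewrite assocK assocVK. Qed.
Lemma assocV_iso X Y Z : is_iso (assocV X Y Z).
Proof. by exists (assoc X Y Z); rewrite assocK assocVK. Qed.

Lemma iso_tens X X' Y Y' (f : hom X X') (g : hom Y Y') :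
  is_iso f -> is_iso g -> is_iso (f ⊗ₘ g).
Proof.
move=> [f' [f'f ff']] [g' [g'g gg']]; exists (f' ⊗ₘ g').
by rewrite -!tensm_comp f'f g'g ff' gg' !tensm1.
Qed.

Definition runitV X := iso_inv (runit_iso X).
Definition lunitV X := iso_inv (lunit_iso X).

Lemma runitV_nat X Y (f : hom X Y) : runitV Y ∘ f = (f ⊗ₘ idm 1) ∘ runitV X.
Proof.
apply: (iso_cancell (runit_iso Y)).
by rewrite !compmA iso_invVK comp1m runit_nat -compmA iso_invVK compm1.
Qed.

Lemma tens_unit_inj X Y (f g : hom X Y) : idm 1 ⊗ₘ f = idm 1 ⊗ₘ g -> f = g.
Proof.
move=> E; apply: (iso_cancelr (lunit_iso X)).
by rewrite -!lunit_nat E.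
Qed.

Lemma tensr_unit_inj X Y (f g : hom X Y) : f ⊗ₘ idm 1 = g ⊗ₘ idm 1 -> f = g.
Proof.
move=> E; apply: (iso_cancelr (runit_iso X)).
by rewrite -!runit_nat E.
Qed.

(** Kelly's argument: tensoring with the unit is faithful, and after tensoring
    the equation follows from the pentagon and two triangles. *)
Lemma lunit_tens X Y : lunit (X ⊗ Y) ∘ assoc 1 X Y = lunit X ⊗ₘ idm Y.
Proof.
apply: tens_unit_inj.
apply: (@iso_cancelr _ _ _ _ _ (assoc 1 (1 ⊗ X) Y ∘ (assoc 1 1 X ⊗ₘ idm Y))).
  by apply: iso_comp (assoc_iso _ _ _) (iso_tens (assoc_iso _ _ _) (iso_id _)).
have := congr1 (compm (idm 1 ⊗ₘ lunit (X ⊗ Y))) (pentagon 1 1 X Y).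
rewrite tens_compr !compmA => <-; rewrite triangle -tensm1 -assoc_nat.
by rewrite -triangle tens_compl !compmA assoc_nat.
Qed.

Lemma lunit_unit : lunit 1 = runit 1.
Proof.
apply: tensr_unit_inj; rewrite -lunit_tens -triangle; congr (_ ∘ _).
by apply: (iso_cancell (lunit_iso 1)); rewrite lunit_nat.
Qed.

End MonoidalCategoryTheory.

(** * The opposite tensor product *)

Section ReversedTensor.
Variable k : fieldType.

Section Monoidal.
Variable C : monoidal_category k.
Implicit Types W X Y Z : C.

Lemma rev_pentagon W X Y Z :
  assocV (Z ⊗ Y) X W ∘ assocV Z Y (X ⊗ W)
    = (assocV Z Y X ⊗ₘ idm W) ∘ assocV Z (Y ⊗ X) W ∘ (idm Z ⊗ₘ assocV Y X W).
Proof.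
apply: (iso_cancell (f := (assoc Z Y (X ⊗ W)) ∘ assoc (Z ⊗ Y) X W)).
  exact: iso_comp (assoc_iso _ _ _) (assoc_iso _ _ _).
rewrite compmA (under_comp _ (assocVK _ _ _)) compm1 assocVK pentagon !compmA.
rewrite (under_comp _ (esym (tens_compl _ _ _))) assocVK tensm1 compm1.
by rewrite (under_comp _ (assocVK _ _ _)) compm1 -tens_compr assocVK tensm1.
Qed.

Lemma rev_triangle X Y :
  (runit Y ⊗ₘ idm X) ∘ assocV Y (unit_ob C) X = idm Y ⊗ₘ lunit X.
Proof. by rewrite -triangle -compmA assocVK compm1. Qed.

(** The category with [X ⊗ Y] replaced by [Y ⊗ X]: left duals in it are right
    duals in [C], so statements about one side give those about the other. *)
Definition rev_monoidal : monoidal_category k := {|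
  mon_cat := C;
  unit_ob := unit_ob C;
  tens := fun X Y : C => Y ⊗ X;
  tensm := fun X X' Y Y' f g => g ⊗ₘ f;
  tensm1 := fun X Y => tensm1 Y X;
  tensm_comp := fun X X' X'' Y Y' Y'' f' f g' g => tensm_comp g' g f' f;
  tensm_linearl := fun X X' Y Y' g => tensm_linearr g;
  tensm_linearr := fun X X' Y Y' f => tensm_linearl f;
  assoc := fun X Y Z => assocV Z Y X;
  assocV := fun X Y Z => assoc Z Y X;
  assocK := fun X Y Z => assocVK Z Y X;
  assocVK := fun X Y Z => assocK Z Y X;
  lunit := fun X => runit X;
  lunit_iso := fun X => runit_iso X;
  runit := fun X => lunit X;
  runit_iso := fun X => lunit_iso X;
  assoc_nat := fun X X' Y Y' Z Z' f g h => assocV_nat h g f;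
  lunit_nat := fun X Y f => runit_nat f;
  runit_nat := fun X Y f => lunit_nat f;
  pentagon := rev_pentagon;
  triangle := rev_triangle
|}.

Lemma runit_tens X Y :
  runit (X ⊗ Y) ∘ assocV X Y (unit_ob C) = idm X ⊗ₘ runit Y.
Proof. exact: (@lunit_tens k rev_monoidal Y X). Qed.

End Monoidal.

Definition rev_braided (C : braided_category k) : braided_category k := {|
  br_cat := rev_monoidal C;
  braid := fun X Y : C => braid Y X;
  braid_iso := fun X Y => braid_iso Y X;
  braid_nat := fun X X' Y Y' f g => braid_nat g f;
  hexagon1 := fun X Y Z => hexagon2 Z Y X;
  hexagon2 := fun X Y Z => hexagon1 Z Y X
|}.

End ReversedTensor.

(** * Duals from invertible zigzags *)

Section Duals.
Variables (k : fieldType) (C : monoidal_category k).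
Implicit Types X Y : C.
Local Notation "1" := (unit_ob C) : lincat_scope.

Definition zigzagX Y X (ev : hom (Y ⊗ X) 1) (coev : hom 1 (X ⊗ Y)) :
    hom (1 ⊗ X) (X ⊗ 1) :=
  (idm X ⊗ₘ ev) ∘ assoc X Y X ∘ (coev ⊗ₘ idm X).

Definition zigzagY Y X (ev : hom (Y ⊗ X) 1) (coev : hom 1 (X ⊗ Y)) : hom Y Y :=
  lunit Y ∘ (ev ⊗ₘ idm Y) ∘ assocV Y X Y ∘ (idm Y ⊗ₘ coev) ∘ runitV Y.

(** By interchange, a cap applied after the zigzag on [Y] is the same cap applied
    after the zigzag on [X]. *)
Lemma ev_zigzagY Y X (ev : hom (Y ⊗ X) 1) (coev : hom 1 (X ⊗ Y)) :
  runit X ∘ zigzagX ev coev = lunit X ->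
  ev ∘ (zigzagY ev coev ⊗ₘ idm X) = ev.
Proof.
move=> zX.
have cap : ev ∘ (lunit Y ⊗ₘ idm X) ∘ ((ev ⊗ₘ idm Y) ⊗ₘ idm X)
    = runit 1 ∘ (ev ⊗ₘ idm 1) ∘ (idm (Y ⊗ X) ⊗ₘ ev) ∘ assoc (Y ⊗ X) Y X.
  rewrite -lunit_tens compmA -lunit_nat lunit_unit.
  rewrite (under_comp _ (assoc_nat _ _ _)) tensm1 !compmA.
  by rewrite (under_comp _ (esym (tens_swap _ _))) !compmA.
have mid : assoc (Y ⊗ X) Y X ∘ (assocV Y X Y ⊗ₘ idm X)
    = assocV Y X (Y ⊗ X) ∘ (idm Y ⊗ₘ assoc X Y X) ∘ assoc Y (X ⊗ Y) X.
  apply: (iso_cancelr (iso_tens (assoc_iso Y X Y) (iso_id X))).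
  rewrite -compmA -tens_compl assocK tensm1 compm1.
  apply: (iso_cancell (assoc_iso Y X (Y ⊗ X))).
  by rewrite pentagon !compmA assocVK comp1m.
rewrite /zigzagY !tens_compl !compmA cap.
rewrite (under_comp _ mid) !compmA (under_comp _ (assoc_nat _ _ _)) !compmA.
rewrite -[in X in X ∘ (idm Y ⊗ₘ assoc _ _ _)]compmA -tensm1 -assocV_nat !compmA.
rewrite -(compmA _ (idm Y ⊗ₘ (idm X ⊗ₘ ev))) -tens_compr.
rewrite -(compmA _ _ (idm Y ⊗ₘ (coev ⊗ₘ idm X))) -tens_compr -/(zigzagX ev coev).
have -> : zigzagX ev coev = runitV X ∘ lunit X.
  by rewrite -zX compmA iso_invK comp1m.
rewrite tens_compr !compmA (under_comp _ (triangle _ _)).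
rewrite -(compmA _ _ (runitV Y ⊗ₘ _)) -tens_compl iso_invVK tensm1 compm1.
rewrite runit_nat -!compmA -[RHS]compm1; congr (_ ∘ _).
by rewrite compmA runit_tens -tens_compr iso_invVK tensm1.
Qed.

(** Rescaling the cap by the inverse of the zigzag on [X] repairs the first
    zigzag identity; the zigzag on [Y] is then an idempotent, and its image is
    a dual of [X]. *)
Lemma left_dual_of_zigzag_iso (hC : idempotent_complete C) Y X
    (ev : hom (Y ⊗ X) 1) (coev : hom 1 (X ⊗ Y)) :
  is_iso (zigzagX ev coev) -> exists Y', is_left_dual Y' X.
Proof.
move=> hz.
have [t [_ ht]] : is_iso (runit X ∘ zigzagX ev coev ∘ lunitV X).
  by apply: iso_comp (iso_inv_iso _); apply: iso_comp hz; apply: runit_iso.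
pose ev1 := ev ∘ (idm Y ⊗ₘ t).
have zX : runit X ∘ zigzagX ev1 coev = lunit X.
  rewrite /zigzagX /ev1 tens_compr !compmA -(compmA _ (idm X ⊗ₘ _)) -assoc_nat.
  rewrite tensm1 compmA -(compmA _ _ (coev ⊗ₘ idm X)) -tens_swap.
  have -> : lunit X = runit X ∘ zigzagX ev coev ∘ lunitV X ∘ t ∘ lunit X.
    by rewrite ht comp1m.
  by rewrite -(compmA _ t) -lunit_nat !compmA (under_comp _ (iso_invK _)) compm1.
have evp := ev_zigzagY zX.
set p := zigzagY ev1 coev in evp.
have pp : p ∘ p = p.
  rewrite {1}/p /zigzagY -compmA runitV_nat compmA.
  rewrite (under_comp _ (esym (tens_swap _ _))) compmA.
  rewrite -(tensm1 X Y) (under_comp _ (assocV_nat _ _ _)) compmA.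
  by rewrite (under_comp _ (esym (tens_compl _ _ _))) evp.
have [Y' [i [q [qi iq]]]] := hC _ _ pp.
exists Y', (ev1 ∘ (i ⊗ₘ idm X)), ((idm X ⊗ₘ q) ∘ coev); split.
  rewrite tens_compl compmA (under_comp _ (assoc_nat _ _ _)) compmA.
  rewrite (under_comp _ (esym (tens_compr _ _ _))) -(compmA ev1) -tens_compl iq evp.
  by rewrite -zX /zigzagX !compmA.
have zY : p ∘ i ∘ runit Y' = lunit Y ∘ (ev1 ⊗ₘ idm Y) ∘ assocV Y X Y
    ∘ (idm Y ⊗ₘ coev) ∘ (i ⊗ₘ idm 1).
  rewrite /p /zigzagY (under_comp _ (runitV_nat _)) compmA.
  by rewrite (under_comp _ (iso_invK _)) compm1.
have -> : runit Y' = q ∘ (p ∘ i ∘ runit Y').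
  by rewrite -iq -(compmA i) qi compm1 compmA qi comp1m.
rewrite zY tens_compl tens_compr !compmA.
rewrite -lunit_nat.
rewrite (under_comp _ (esym (tens_swap _ coev))) compmA -(tensm1 X Y).
rewrite (under_comp _ (assocV_nat _ _ _)) compmA.
rewrite (under_comp _ (assocV_nat _ _ _)) compmA tensm1.
rewrite -(compmA _ _ (idm _ ⊗ₘ q)) tens_swap compmA.
by rewrite (under_comp _ (tens_swap _ _)) compmA.
Qed.

End Duals.

(** * Negligible endomorphisms and partial traces *)

Section Negligible.
Variables (k : fieldType) (C : monoidal_category k).
Implicit Types P T X Y Z : C.
Local Notation "1" := (unit_ob C) : lincat_scope.

(** Closed diagrams through [h] vanish.  The remaining strands are all placed
    to the right of [T], which is no restriction when there is a braiding. *)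
Definition negligible T (h : hom T T) : Prop :=
  forall Z (u : hom (T ⊗ Z) 1) (v : hom 1 (T ⊗ Z)), u ∘ (h ⊗ₘ idm Z) ∘ v = 0.

Lemma negligible0 T : negligible (0 : hom T T).
Proof. by move=> Z u v; rewrite tens0m compm0 comp0m. Qed.

Lemma negligibleD T (g h : hom T T) :
  negligible g -> negligible h -> negligible (g + h).
Proof. by move=> Ng Nh Z u v; rewrite tensDm compmD compDm Ng Nh addr0. Qed.

Lemma negligibleZ T (a : k) (h : hom T T) : negligible h -> negligible (a *: h).
Proof. by move=> Nh Z u v; rewrite tensZm compmZ compZm Nh scaler0. Qed.

Lemma negligible_sum T (I : finType) (Q : pred I) (F : I -> hom T T) :
  (forall i, Q i -> negligible (F i)) -> negligible (\sum_(i | Q i) F i).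
Proof.
by move=> NF; apply: big_ind => //; [apply: negligible0 | apply: negligibleD].
Qed.

Lemma negligible_conj T T' (g : hom T T') (h : hom T T) (f : hom T' T) :
  negligible h -> negligible (g ∘ h ∘ f).
Proof.
move=> Nh Z u v; rewrite !tens_compl !compmA -(compmA _ _ v).
exact: Nh.
Qed.

Lemma negligible_tens T Z (h : hom T T) :
  negligible h -> negligible (h ⊗ₘ idm Z).
Proof.
move=> Nh W u v.
rewrite -(comp1m v) -(assocK T Z W) !compmA -(compmA _ _ (assocV _ _ _)).
rewrite -assocV_nat tensm1 compmA -(compmA _ _ v).
exact: Nh.
Qed.

Section PartialTrace.
Variables (X Y : C).
Implicit Types (e : hom (X ⊗ Y) 1) (c : hom 1 (X ⊗ Y)).

Definition cap e T : hom ((T ⊗ X) ⊗ Y) T :=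
  runit T ∘ (idm T ⊗ₘ e) ∘ assoc T X Y.

Definition cup c T : hom T ((T ⊗ X) ⊗ Y) :=
  assocV T X Y ∘ (idm T ⊗ₘ c) ∘ runitV T.

(** A trace over the factor [X]; as [e] and [c] need not be dual to each other,
    it need not be cyclic in that factor. *)
Definition ptrace e c T (h : hom (T ⊗ X) (T ⊗ X)) : hom T T :=
  cap e T ∘ (h ⊗ₘ idm Y) ∘ cup c T.

Lemma cap_nat e T (f : hom T T) :
  cap e T ∘ ((f ⊗ₘ idm X) ⊗ₘ idm Y) = f ∘ cap e T.
Proof.
rewrite /cap (under_comp _ (assoc_nat _ _ _)) compmA tensm1.
by rewrite (under_comp _ (esym (tens_swap _ _))) compmA runit_nat !compmA.
Qed.

Lemma cup_nat c T (f : hom T T) :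
  ((f ⊗ₘ idm X) ⊗ₘ idm Y) ∘ cup c T = cup c T ∘ f.
Proof.
rewrite /cup !compmA -assocV_nat tensm1 (under_comp _ (tens_swap _ _)) compmA.
by rewrite (under_comp _ (esym (runitV_nat _))) compmA.
Qed.

Lemma ptrace_bimodule e c T (f g : hom T T) (h : hom (T ⊗ X) (T ⊗ X)) :
  ptrace e c ((f ⊗ₘ idm X) ∘ h ∘ (g ⊗ₘ idm X)) = f ∘ ptrace e c h ∘ g.
Proof.
rewrite /ptrace !tens_compl.
move: (cap e T) (cup c T) (cap_nat e f) (cup_nat c g) => p q pf qg.
by rewrite !compmA pf (under_comp _ qg) compmA.
Qed.

Lemma ptrace_id e c T : e ∘ c = idm 1 -> ptrace e c (idm (T ⊗ X)) = idm T.
Proof.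
move=> ec; rewrite /ptrace tensm1 compm1 /cap /cup !compmA.
rewrite (under_comp _ (assocVK _ _ _)) compm1 (under_comp _ (esym (tens_compr _ _ _))).
by rewrite ec tensm1 compm1 iso_invVK.
Qed.

Lemma ptrace_sum e c T (I : finType) (F : I -> hom (T ⊗ X) (T ⊗ X)) :
  ptrace e c (\sum_i F i) = \sum_i ptrace e c (F i).
Proof. by rewrite /ptrace tens_suml comp_sumr comp_suml. Qed.

Lemma negligible_ptrace e c T (h : hom (T ⊗ X) (T ⊗ X)) :
  negligible h -> negligible (ptrace e c h).
Proof.
move=> Nh; exact: (negligible_conj (cap e T) (cup c T) (negligible_tens Nh)).
Qed.

(** The cap involves only [X] and [Y]: by the pentagon and [runit_tens], the
    factor [P] can be moved out of it. *)
Lemma cap_tens e P T :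
  cap e (P ⊗ T) ∘ (assocV P T X ⊗ₘ idm Y)
    = (idm P ⊗ₘ cap e T) ∘ assoc P (T ⊗ X) Y.
Proof.
apply: (iso_cancelr (iso_tens (assoc_iso P T X) (iso_id Y))).
rewrite -(compmA (cap _ _)) -tens_compl assocK tensm1 compm1.
rewrite -(compmA (idm P ⊗ₘ cap e T)) /cap !tens_compr -!compmA.
rewrite [in RHS](compmA (idm P ⊗ₘ assoc _ _ _)) -pentagon.
rewrite -runit_tens -!compmA; congr (_ ∘ _).
rewrite !compmA; congr (_ ∘ _).
by rewrite assocV_nat -compmA assocK compm1 tensm1.
Qed.

Lemma cup_tens c P T :
  (assoc P T X ⊗ₘ idm Y) ∘ cup c (P ⊗ T)
    = assocV P (T ⊗ X) Y ∘ (idm P ⊗ₘ cup c T).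
Proof.
apply: (iso_cancell (f := (idm P ⊗ₘ assoc T X Y) ∘ assoc P (T ⊗ X) Y)).
  exact: iso_comp (iso_tens (iso_id P) (assoc_iso _ _ _)) (assoc_iso _ _ _).
rewrite [LHS]compmA -pentagon [RHS]compmA (under_comp _ (assocVK _ _ _)) compm1.
rewrite -tens_compr /cup !compmA (under_comp _ (assocVK _ _ _)) compm1.
rewrite assocVK comp1m -(tensm1 P T) assoc_nat !tens_compr -compmA.
congr (_ ∘ _); apply: (iso_cancelr (runit_iso (P ⊗ T))).
rewrite -compmA iso_invK compm1.
apply: (iso_cancelr (assocV_iso P T 1)).
by rewrite assocVK -compmA runit_tens -tens_compr iso_invK tensm1.
Qed.

Lemma ptrace_tens e c P T (h : hom (T ⊗ X) (T ⊗ X)) :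
  ptrace e c (assocV P T X ∘ (idm P ⊗ₘ h) ∘ assoc P T X) = idm P ⊗ₘ ptrace e c h.
Proof.
rewrite /ptrace !tens_compl.
move: (cap_tens e P T) (cup_tens c P T).
move: (cap e _) (cup c _) (cap e T) (cup c T) => p q p' q' Ep Eq.
rewrite !compmA Ep (under_comp _ Eq) compmA (under_comp _ (assoc_nat _ _ _)).
by rewrite compmA (under_comp _ (assocVK _ _ _)) compm1 !tens_compr.
Qed.

End PartialTrace.
End Negligible.

(** * The braid relation *)

Section BraidGroupAction.
Variables (k : fieldType) (C : braided_category k).
Implicit Types P T : C.
Local Notation "1" := (unit_ob C) : lincat_scope.

Lemma negligible_tensl P T (h : hom T T) :
  negligible h -> negligible (idm P ⊗ₘ h).
Proof.
move=> Nh; have [bV [bVb _]] := braid_iso P T.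
rewrite -(comp1m (idm P ⊗ₘ h)) -bVb -compmA braid_nat compmA.
exact: (negligible_conj bV (braid P T) (negligible_tens Nh)).
Qed.

Variable X : C.
Implicit Types f g : hom (X ⊗ X) (X ⊗ X).

Definition on_last_two T f : hom ((T ⊗ X) ⊗ X) ((T ⊗ X) ⊗ X) :=
  assocV T X X ∘ (idm T ⊗ₘ f) ∘ assoc T X X.

Lemma on_last_two_inv T f g :
  f ∘ g = idm _ -> on_last_two T f ∘ on_last_two T g = idm _.
Proof.
move=> fg; rewrite /on_last_two !compmA (under_comp _ (assocVK _ _ _)) compm1.
by rewrite (under_comp _ (esym (tens_compr _ _ _))) fg tensm1 compm1 assocK.
Qed.

Lemma on_last_two_nat T f (h : hom T T) :
  on_last_two T f ∘ ((h ⊗ₘ idm X) ⊗ₘ idm X)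
    = ((h ⊗ₘ idm X) ⊗ₘ idm X) ∘ on_last_two T f.
Proof.
rewrite /on_last_two (under_comp _ (assoc_nat _ _ _)) tensm1 !compmA.
rewrite (under_comp _ (esym (tens_swap _ _))) compmA -(tensm1 X X).
by rewrite assocV_nat.
Qed.

(** Both sides become morphisms of the form [idm T ⊗ₘ _] after reassociation;
    on three strands the relation is the naturality of the braiding with
    respect to the braiding itself, by the hexagon. *)
Lemma braid_relation T (b := braid X X) :
  on_last_two (T ⊗ X) b ∘ (on_last_two T b ⊗ₘ idm X) ∘ on_last_two (T ⊗ X) b
    = (on_last_two T b ⊗ₘ idm X) ∘ on_last_two (T ⊗ X) b
        ∘ (on_last_two T b ⊗ₘ idm X).
Proof.
pose a := assoc T (X ⊗ X) X ∘ (assoc T X X ⊗ₘ idm X).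
have a_iso : is_iso a.
  exact: iso_comp (assoc_iso _ _ _) (iso_tens (assoc_iso _ _ _) (iso_id _)).
have a1 : a ∘ (on_last_two T b ⊗ₘ idm X) = (idm T ⊗ₘ (b ⊗ₘ idm X)) ∘ a.
  rewrite /a /on_last_two !tens_compl !compmA.
  rewrite (under_comp _ (esym (tens_compl X (assoc T X X) (assocV T X X)))).
  rewrite assocVK tensm1 compm1.
  by rewrite assoc_nat.
have a2 : a ∘ on_last_two (T ⊗ X) b = (idm T ⊗ₘ on_last_two X b) ∘ a.
  have aE : a = (idm T ⊗ₘ assocV X X X) ∘ assoc T X (X ⊗ X) ∘ assoc (T ⊗ X) X X.
    by rewrite -compmA pentagon !compmA -tens_compr assocK tensm1 comp1m.
  rewrite aE /on_last_two !compmA (under_comp _ (assocVK _ _ _)) compm1.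
  rewrite -(tensm1 T X) (under_comp _ (assoc_nat _ _ _)) !tens_compr !compmA.
  by rewrite (under_comp _ (esym (tens_compr _ _ _))) assocVK !tensm1 compm1.
have yb : on_last_two X b ∘ (b ⊗ₘ idm X) = braid X (X ⊗ X) ∘ assoc X X X.
  apply: (iso_cancell (assoc_iso X X X)).
  by rewrite [RHS]compmA hexagon1 /on_last_two !compmA assocVK comp1m.
have yb3 : on_last_two X b ∘ (b ⊗ₘ idm X) ∘ on_last_two X b
    = (b ⊗ₘ idm X) ∘ on_last_two X b ∘ (b ⊗ₘ idm X).
  rewrite -[RHS]compmA yb [RHS]compmA -braid_nat /on_last_two -/b !compmA.
  by rewrite (under_comp _ (assocVK _ _ _)) compm1.
apply: (iso_cancell a_iso).
move: (on_last_two (T ⊗ X) b) (on_last_two T b ⊗ₘ idm X) (on_last_two X b)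
  a a_iso a1 a2 yb3 {yb} => t s m a _ a1 a2 yb3.
rewrite !compmA a1 a2 (under_comp _ a1) (under_comp _ a2) !compmA.
rewrite (under_comp _ a1) (under_comp _ a2) !compmA -!tens_compr.
by rewrite yb3.
Qed.

End BraidGroupAction.

(** * Factorial growth *)

Section FactorialGrowth.
Variables (k : fieldType) (C : braided_category k) (X : C).
Local Notation "1" := (unit_ob C) : lincat_scope.
Local Notation pow := (tens_pow X).
Local Notation End T := (hom T T).

Lemma braid_conj (U : C) (s s' t t' : End U) :
  s ∘ s' = idm U -> t' ∘ t = idm U -> s ∘ t ∘ s = t ∘ s ∘ t ->
  s ∘ t ∘ s' = t' ∘ s ∘ t.
Proof.
move=> ss' t't E.
rewrite -[LHS]comp1m -t't !compmA -(compmA t' t s) -(compmA t' (t ∘ s) t).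
by rewrite -E !compmA (under_comp _ ss') compm1.
Qed.

Lemma braid_conjV (U : C) (s s' t t' : End U) :
  s ∘ s' = idm U -> s' ∘ s = idm U -> t ∘ t' = idm U -> t' ∘ t = idm U ->
  s ∘ t ∘ s = t ∘ s ∘ t -> s ∘ t' ∘ s' = t' ∘ s' ∘ t.
Proof.
move=> ss' s's tt' t't E.
apply: (@iso_cancelr _ _ _ _ _ (s ∘ t ∘ s')).
  by apply: iso_comp; [apply: iso_comp; [exists s' | exists t'] | exists s].
rewrite {2}(braid_conj ss' t't E) !compmA.
rewrite (under_comp _ s's) compm1 (under_comp _ t't) compm1 ss'.
by rewrite (under_comp _ tt') compm1 (under_comp _ s's) compm1 t't.
Qed.

Variable bV : End (X ⊗ X).
Let b := braid X X.
Hypotheses (bVb : bV ∘ b = idm (X ⊗ X)) (bbV : b ∘ bV = idm (X ⊗ X)).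

(** The braid that brings the [d]-th strand from the right, counted from [0], to
    the last place by positive crossings.  For [d < n] these braids lie in
    different cosets of the braid group on one strand less. *)
Fixpoint coset_braid (n d : nat) {struct d} : End (pow n) :=
  if d is d'.+1 then
    match n return End (pow n) with
    | m.+2 => on_last_two (pow m) b ∘ (coset_braid m.+1 d' ⊗ₘ idm X)
    | m => idm (pow m)
    end
  else idm (pow n).

Fixpoint coset_braidV (n d : nat) {struct d} : End (pow n) :=
  if d is d'.+1 then
    match n return End (pow n) with
    | m.+2 => (coset_braidV m.+1 d' ⊗ₘ idm X) ∘ on_last_two (pow m) bV
    | m => idm (pow m)
    end
  else idm (pow n).

Lemma coset_braidK n d : coset_braid n d ∘ coset_braidV n d = idm (pow n).
Proof.
elim: d n => [|d IHd] [|[|m]] /=; rewrite ?comp1m //.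
move: (on_last_two_inv (pow m) bbV).
move: (on_last_two _ b) (on_last_two _ bV) => s s' ss'.
rewrite compmA (under_comp _ (esym (tens_compl _ _ _))) (IHd m.+1) tensm1.
by rewrite compm1.
Qed.

(** In the inductive step the generator [s] of the new last two strands
    conjugates the previous generator [t], and [s t s^-1 = t^-1 s t] by the braid
    relation. *)
Lemma coset_braid_double_coset n d d' : (d < n.+2)%N -> (d' < n.+2)%N -> d <> d' ->
  exists (u v : End (pow n.+1)) f, (f = b \/ f = bV) /\
    coset_braid n.+2 d ∘ coset_braidV n.+2 d'
      = (u ⊗ₘ idm X) ∘ on_last_two (pow n) f ∘ (v ⊗ₘ idm X).
Proof.
elim: n d d' => [|n IHn] [|d] [|d'] // ld ld' nd.
- exists (coset_braidV 1 d'), (idm _), bV; split; first by right.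
  by rewrite tensm1 compm1 [LHS]comp1m.
- exists (idm _), (coset_braid 1 d), b; split; first by left.
  by rewrite tensm1 comp1m [LHS]compm1.
- by case: d d' ld ld' nd => [|d] [|d'].
- exists (coset_braidV n.+2 d'), (idm _), bV; split; first by right.
  by rewrite tensm1 compm1 [LHS]comp1m.
- exists (idm _), (coset_braid n.+2 d), b; split; first by left.
  by rewrite tensm1 comp1m [LHS]compm1.
have [|u [v [f [hf E]]]] := IHn d d' ld ld'; first by move=> e; apply: nd; rewrite e.
set s := on_last_two (pow n.+1) b.
set s' := on_last_two (pow n.+1) bV.
have ss' : s ∘ s' = idm _ by apply: on_last_two_inv.
pose t (h : End (X ⊗ X)) : End (pow n.+3) := on_last_two (pow n) h ⊗ₘ idm X.
have tt g h : g ∘ h = idm _ -> t g ∘ t h = idm _.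
  by move=> gh; rewrite -(tensm1 (pow n.+2) X) -(on_last_two_inv (pow n) gh) tens_compl.
have sts : s ∘ t b ∘ s = t b ∘ s ∘ t b := braid_relation X (pow n).
have conj_s : s ∘ (on_last_two (pow n) f ⊗ₘ idm X) ∘ s'
    = (on_last_two (pow n) bV ⊗ₘ idm X) ∘ on_last_two (pow n.+1) f
      ∘ (on_last_two (pow n) b ⊗ₘ idm X).
  rewrite -!/(t _).
  case: hf => ->; first by apply: braid_conj => //; apply: tt.
  by apply: braid_conjV => //; [apply: on_last_two_inv | apply: tt | apply: tt].
exists (u ⊗ₘ idm X ∘ on_last_two (pow n) bV), (on_last_two (pow n) b ∘ (v ⊗ₘ idm X)), f.
split=> //.
transitivity (s ∘ ((coset_braid n.+2 d ∘ coset_braidV n.+2 d') ⊗ₘ idm X) ∘ s').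
  by rewrite tens_compl !compmA.
have su : s ∘ ((u ⊗ₘ idm X) ⊗ₘ idm X) = ((u ⊗ₘ idm X) ⊗ₘ idm X) ∘ s.
  exact: on_last_two_nat.
have vs : ((v ⊗ₘ idm X) ⊗ₘ idm X) ∘ s' = s' ∘ ((v ⊗ₘ idm X) ⊗ₘ idm X).
  by rewrite -on_last_two_nat.
rewrite E; move: conj_s su vs {E t tt sts}; move: (s) (s') (on_last_two _ _).
move: (on_last_two (pow n) f) (on_last_two (pow n) bV) (on_last_two (pow n) b).
move=> q r r' p p' w conj_s su vs.
rewrite !tens_compl !compmA su (under_comp _ vs) compmA.
by rewrite -(compmA _ p _) -(compmA _ _ p') conj_s !compmA.
Qed.

Variables (Y : C) (e : hom (X ⊗ Y) 1) (c : hom 1 (X ⊗ Y)).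
Hypotheses (hunit : scalar_unit_endomorphisms C) (ec : e ∘ c = idm 1).
Hypothesis Nb : negligible (ptrace e c b).
Hypothesis NbV : negligible (ptrace e c bV).

Lemma negligible_ptrace_coset_braid n d d' :
  (d < n.+1)%N -> (d' < n.+1)%N -> d <> d' ->
  negligible (ptrace e c (T := pow n) (coset_braid n.+1 d ∘ coset_braidV n.+1 d')).
Proof.
case: n => [|n] ld ld' nd; first by case: d d' ld ld' nd => [|d] [|d'].
have [u [v [f [hf E]]]] := coset_braid_double_coset ld ld' nd.
rewrite E (@ptrace_bimodule _ _ _ _ e c (pow n.+1)) ptrace_tens.
by apply: negligible_conj; apply: negligible_tensl; case: hf => ->.
Qed.

(** Composing a sum of terms [(f_d ⊗ₘ idm X) ∘ coset_braid n.+1 d] with the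
    inverse of one of these braids and taking the partial trace isolates, modulo
    negligible morphisms, the coefficient [f_d] of that braid. *)
Lemma factorial_family n :
  exists (T : finType) (w : T -> End (pow n)), #|T| = n`! /\
    forall l : T -> k, negligible (\sum_t l t *: w t) -> forall t, l t = 0.
Proof.
elim: n => [|n [T [w [cT w_indep]]]].
  exists 'I_1, (fun=> idm 1); split; first by rewrite card_ord.
  move=> l; rewrite big_ord1 => /(_ 1 (lunit 1) (lunitV 1)).
  rewrite tensZm compmZ compZm tensm1 compm1 iso_invVK => E t.
  by rewrite ord1; apply: (bij_inj hunit); rewrite E scale0r.
exists (T * 'I_n.+1)%type.
exists (fun p : T * 'I_n.+1 => (w p.1 ⊗ₘ idm X) ∘ coset_braid n.+1 p.2).
split; first by rewrite card_prod cT card_ord factS mulnC.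
move=> l Nl [t0 d0].
pose f (d : 'I_n.+1) := \sum_t l (t, d) *: w t.
suff Nf : negligible (f d0) by exact: (w_indep (fun t => l (t, d0))).
have El : \sum_(p : T * 'I_n.+1) l p *: ((w p.1 ⊗ₘ idm X) ∘ coset_braid n.+1 p.2)
    = \sum_(d < n.+1) (f d ⊗ₘ idm X) ∘ coset_braid n.+1 d.
  transitivity (\sum_t \sum_(d < n.+1)
      l (t, d) *: ((w t ⊗ₘ idm X) ∘ coset_braid n.+1 d)).
    by rewrite pair_bigA; apply: eq_bigr => -[].
  rewrite exchange_big; apply: eq_bigr => d _ /=.
  rewrite /f tens_suml comp_suml; apply: eq_bigr => t _.
  by rewrite tensZm compZm.
rewrite El in Nl.
have := negligible_ptrace e c (negligible_conj (idm _) (coset_braidV n.+1 d0) Nl).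
rewrite comp1m comp_suml ptrace_sum.
have Ed d : ptrace e c ((f d ⊗ₘ idm X) ∘ coset_braid n.+1 d ∘ coset_braidV n.+1 d0)
    = f d ∘ ptrace e c (coset_braid n.+1 d ∘ coset_braidV n.+1 d0).
  by rewrite -compmA -[X in ptrace e c X]compm1 -tensm1 ptrace_bimodule compm1.
rewrite (bigD1 d0) //= Ed coset_braidK ptrace_id // compm1 => Nsum.
rewrite -[f d0](addrK (\sum_(d < n.+1 | d != d0)
  ptrace e c ((f d ⊗ₘ idm X) ∘ coset_braid n.+1 d ∘ coset_braidV n.+1 d0))) -scaleN1r.
apply: negligibleD Nsum _; apply: negligibleZ; apply: negligible_sum => d nd.
rewrite Ed -[_ ∘ _]compm1; apply: negligible_conj.
by apply: negligible_ptrace_coset_braid => //; apply/eqP; rewrite val_eqE.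
Qed.

Lemma no_moderate_growth : ~ object_moderate_growth X.
Proof.
move=> [n]; have [T [w [<- w_indep]]] := factorial_family n.
apply/negP; rewrite -leqNgt; apply: (@card_le_dim _ _ _ w) => l El.
by apply: w_indep; rewrite El; apply: negligible0.
Qed.

End FactorialGrowth.

(** * Existence of duals *)

Section ExistenceOfDuals.
Variables (k : fieldType) (C : braided_category k).
Implicit Types X Y Z : C.
Local Notation "1" := (unit_ob C) : lincat_scope.

(** By the hexagon, moving the first copy of [X] through the cup turns the
    partial trace of [b1] into the zigzag for the cap precomposed with the
    crossing [b2] of [X] and [Y].  The crossings are arbitrary morphisms here
    so that this applies to the braiding and to its inverse. *)
Lemma left_dual_of_ptrace_iso (hC : idempotent_complete C) X Y
    (e : hom (X ⊗ Y) 1) (c : hom 1 (X ⊗ Y))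
    (b1 : hom (X ⊗ X) (X ⊗ X)) (b2 : hom (X ⊗ Y) (Y ⊗ X))
    (b12 : hom (X ⊗ X ⊗ Y) ((X ⊗ Y) ⊗ X)) (bu : hom (X ⊗ 1) (1 ⊗ X)) :
  is_iso b2 -> is_iso bu -> b12 ∘ (idm X ⊗ₘ c) = (c ⊗ₘ idm X) ∘ bu ->
  assoc X Y X ∘ b12 ∘ assoc X X Y
    = (idm X ⊗ₘ b2) ∘ assoc X X Y ∘ (b1 ⊗ₘ idm Y) ->
  is_iso (ptrace e c (T := X) b1) -> exists Y', is_left_dual Y' X.
Proof.
move=> [b2V [b2Vb2 b2b2V]] [buV [buVbu bubuV]] nat hex hiso.
apply: (@left_dual_of_zigzag_iso _ _ hC Y X (e ∘ b2V) c).
have hex' : assoc X Y X ∘ b12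
    = (idm X ⊗ₘ b2) ∘ assoc X X Y ∘ (b1 ⊗ₘ idm Y) ∘ assocV X X Y.
  by rewrite -hex -compmA assocVK compm1.
have -> : zigzagX (e ∘ b2V) c = runitV X ∘ ptrace e c b1 ∘ runit X ∘ buV.
  rewrite -[LHS]compm1 -bubuV compmA; congr (_ ∘ _).
  rewrite /zigzagX -compmA -nat compmA (under_comp _ hex') !compmA.
  rewrite -tens_compr -(compmA e) b2Vb2 compm1 iso_invK comp1m.
  by rewrite (under_comp _ (iso_invK _)) compm1.
apply: iso_comp; last by exists bu.
apply: iso_comp (runit_iso X); apply: iso_comp hiso.
exact: iso_inv_iso.
Qed.

(** If no such partial trace is invertible, all of them become negligible after
    composition with an extremal endomorphism [a]; absorbing [a] into the cap
    yields the hypotheses of factorial growth. *)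
Lemma exists_left_dual (hC : idempotent_complete C)
    (hunit : scalar_unit_endomorphisms C) X (hX : indecomposable X)
    (hgrowth : object_moderate_growth X) Z (u : hom (X ⊗ Z) 1)
    (v : hom 1 (X ⊗ Z)) (uv : u ∘ v = idm 1) :
  exists Y, is_left_dual Y X.
Proof.
case: (classic (exists Y, is_left_dual Y X)) => // nodual.
have id1 : idm 1 <> 0.
  move=> E; have := bij_inj hunit (x1 := 0) (x2 := 1%R).
  by rewrite E !scaler0 => /(_ erefl) /eqP; rewrite eq_sym oner_eq0.
have [|a Na aP] := exists_extremal_endomorphism hC hX (@negligible0 _ _ X).
  by move/(_ Z u v); rewrite tensm1 compm1 uv.
(* Rescale a closed diagram that detects [a]. *)
have [Y [e0 [c ec]]] : exists Y (e : hom (X ⊗ Y) 1) (c : hom 1 (X ⊗ Y)),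
    e ∘ (a ⊗ₘ idm Y) ∘ c = idm 1.
  case: (classic (exists Y (e : hom (X ⊗ Y) 1) (c : hom 1 (X ⊗ Y)),
    e ∘ (a ⊗ₘ idm Y) ∘ c = idm 1)) => // nex.
  case: Na => Y e c; case: hunit => g _ gK.
  have := gK (e ∘ (a ⊗ₘ idm Y) ∘ c); set l := g _ => El.
  case: (eqVneq l 0) => [l0|l0]; first by rewrite -El l0 scale0r.
  case: nex; exists Y, (l^-1 *: e), c; rewrite !compZm -El scalerA.
  by rewrite mulVf ?scale1r.
have ptraceE f : f ∘ (a ⊗ₘ idm X) = (idm X ⊗ₘ a) ∘ f ->
    ptrace (e0 ∘ (a ⊗ₘ idm Y)) c (T := X) f = ptrace e0 c f ∘ a.
  move=> fa; rewrite /ptrace.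
  have -> : cap (e0 ∘ (a ⊗ₘ idm Y)) X = cap e0 X ∘ ((idm X ⊗ₘ a) ⊗ₘ idm Y).
    by rewrite /cap tens_compr -!compmA assoc_nat.
  rewrite -[RHS]compmA -cup_nat.
  move: (cap e0 X) (cup c X) => p q.
  by rewrite compmA -(compmA p _ (f ⊗ₘ _)) -(compmA p (f ⊗ₘ _)) -!tens_compl fa.
have [bV [bVb bbV]] := braid_iso X X.
have Nb f : f ∘ (a ⊗ₘ idm X) = (idm X ⊗ₘ a) ∘ f ->
    ~ is_iso (ptrace e0 c (T := X) f) ->
    negligible (ptrace (e0 ∘ (a ⊗ₘ idm Y)) c (T := X) f).
  by move=> fa niso; rewrite ptraceE //; apply: aP.
exfalso; apply: (no_moderate_growth bVb bbV hunit ec _ _ hgrowth); apply: Nb.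
- exact: braid_nat.
- move=> niso; apply: nodual.
  apply: (left_dual_of_ptrace_iso hC (braid_iso X Y) (braid_iso X 1) _ _ niso).
    exact: braid_nat.
  exact: hexagon1.
- apply: (iso_cancell (braid_iso X X)).
  by rewrite !compmA bbV comp1m braid_nat -compmA bbV compm1.
move=> niso; apply: nodual.
have [b2 [b2K b2VK]] := braid_iso Y X.
have [b12 [b12K b12VK]] := braid_iso (X ⊗ Y) X.
have [bu [buK buVK]] := braid_iso 1 X.
have b2_iso : is_iso b2 by exists (braid Y X).
have bu_iso : is_iso bu by exists (braid 1 X).
apply: (left_dual_of_ptrace_iso hC b2_iso bu_iso (b12 := b12) _ _ niso).
  apply: (iso_cancell (braid_iso (X ⊗ Y) X)).
  by rewrite !compmA b12VK comp1m braid_nat -compmA buVK compm1.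
(* The inverses of the two sides of the second hexagon. *)
apply: (iso_cancell (f :=
  (braid X X ⊗ₘ idm Y) ∘ assocV X X Y ∘ (idm X ⊗ₘ braid Y X))).
  apply: iso_comp (iso_tens (iso_id X) (braid_iso Y X)).
  exact: iso_comp (iso_tens (braid_iso X X) (iso_id Y)) (assocV_iso _ _ _).
rewrite -{1}hexagon2 !compmA (under_comp _ (assocK _ _ _)) compm1.
rewrite (under_comp _ b12VK) compm1 assocK.
rewrite (under_comp _ (esym (tens_compr _ _ _))) b2VK tensm1 compm1.
by rewrite (under_comp _ (assocK _ _ _)) compm1 -tens_compl bbV tensm1.
Qed.

(** Powers for the opposite tensor product are nested to the other side; the
    braiding moves each new factor back. *)
Lemma tens_pow_rev X n : exists f : hom (tens_pow X n)
    (tens_pow (X : rev_braided C) n : C), is_iso f.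
Proof.
elim: n => [|n [f hf]]; first by exists (idm 1); apply: iso_id.
exists (braid _ X ∘ (f ⊗ₘ idm X)).
exact: iso_comp (braid_iso _ X) (iso_tens hf (iso_id X)).
Qed.

Lemma object_moderate_growth_rev X :
  object_moderate_growth X -> object_moderate_growth (X : rev_braided C).
Proof.
move=> [n hn]; exists n; have [f [g [gf fg]]] := tens_pow_rev X n.
apply: leq_ltn_trans hn; apply: (@dim_end_le k C _ _ g).
by exists f.
Qed.

End ExistenceOfDuals.

Theorem corollary1p2 (k : fieldType) (C : braided_category k)
    (hC : cauchy_complete C) (hunit : scalar_unit_endomorphisms C)
    (hgrowth : moderate_growth C) (X : C) (hX : non_negligible X) :
  rigid X.
Proof.
case: hC => _ hC; case: hX => hX [Z [W [i [_ [p [_ [pi _ _ _ _]]]]]]].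
have hg := hgrowth X hX.
split.
  have [bV [bVb _]] := braid_iso Z X.
  apply: (exists_left_dual hC hunit hX hg (u := p ∘ bV) (v := braid Z X ∘ i)).
  by rewrite compmA (under_comp _ bVb) compm1.
have [Y [ev [coev [z1 z2]]]] := @exists_left_dual k (rev_braided C) hC hunit X hX
  (object_moderate_growth_rev hg) Z p i pi.
by exists Y, ev, coev; split.
Qed.
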